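(* Let $G_1$, $G_2$ and $G_k$ be generators over alphabets $\Sigma_1$, $\Sigma_2$ and $\Sigma_k$, respectively, where $\Sigma_1\cap\Sigma_2\subseteq\Sigma_k\subseteq\Sigma_1\cup\Sigma_2$. Let $K\subseteq L_m(G_1\parallel G_2\parallel G_k)$ be a language such that $K$ and $\overline{K}$ are conditionally decomposable with respect to $\Sigma_1,\Sigma_2,\Sigma_k$. For $i=1,2$, let $\mathrm{supC}_{i+k}$ be the supremal controllable sublanguage of $P_{i+k}(K)$ with respect to $L(G_i\parallel G_k)$ and $\Sigma_{i+k,u}$. Assume that $\mathrm{supC}_{1+k}$ and $\mathrm{supC}_{2+k}$ are synchronously nonconflicting. If $P_k(\mathrm{supC}_{1+k})\cap P_k(\mathrm{supC}_{2+k})$ is controllable with respect to $L(G_k)$ and $\Sigma_{k,u}$, then $\mathrm{supC}_{1+k}\parallel\mathrm{supC}_{2+k}$ equals the supremal conditionally controllable sublanguage of $K$ for generators $G_1,G_2,G_k$.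
   Context: A generator is $G=(Q,\Sigma,f,q_0,Q_m)$ with finite state set $Q$, finite nonempty alphabet $\Sigma$, partial transition function $f:Q\times\Sigma\to Q$ (extended to words), initial state $q_0$ and marked states $Q_m\subseteq Q$; $L(G)=\{s\in\Sigma^*\mid f(q_0,s)\text{ is defined}\}$ and $L_m(G)=\{s\mid f(q_0,s)\in Q_m\}$. $\overline{L}$ denotes the prefix closure of $L$. A (natural) projection $\Sigma^*\to\Sigma_0^*$, $\Sigma_0\subseteq\Sigma$, erases the letters not in $\Sigma_0$. For $L_i\subseteq\Sigma_i^*$, $L_1\parallel L_2=P_1^{-1}(L_1)\cap P_2^{-1}(L_2)$, where $P_i:(\Sigma_1\cup\Sigma_2)^*\to\Sigma_i^*$ are the projections; for generators $\parallel$ is the synchronous product, satisfying $L(G_1\parallel G_2)=L(G_1)\parallel L(G_2)$ and $L_m(G_1\parallel G_2)=L_m(G_1)\parallel L_m(G_2)$. Languages $A,B$ are synchronously nonconflicting if $\overline{A\parallel B}=\overline{A}\parallel\overline{B}$. The global alphabet $\Sigma=\Sigma_1\cup\Sigma_2$ is partitioned into controllable events $\Sigma_c$ and uncontrollable events $\Sigma_u=\Sigma\setminus\Sigma_c$. Put $\Sigma_{i+k}=\Sigma_i\cup\Sigma_k$, $\Sigma_{i+k,u}=\Sigma_{i+k}\cap\Sigma_u$, $\Sigma_{k,u}=\Sigma_k\cap\Sigma_u$. $P_{i+k}:\Sigma^*\to\Sigma_{i+k}^*$ is the projection, and $P_k$ is the projection onto $\Sigma_k^*$. A language $M$ is controllable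 with respect to a prefix-closed language $L$ and a set of events $\Sigma_u'$ if $\overline{M}\Sigma_u'\cap L\subseteq\overline{M}$. The supremal controllable sublanguage of $M$ with respect to $L,\Sigma_u'$ is the union of all sublanguages of $M$ that are controllable with respect to $L,\Sigma_u'$ (it is itself controllable). A language $M\subseteq\Sigma^*$ is conditionally decomposable with respect to $\Sigma_1,\Sigma_2,\Sigma_k$ if $M=P_{1+k}(M)\parallel P_{2+k}(M)$. A language $M\subseteq L_m(G_1\parallel G_2\parallel G_k)$ is conditionally controllable for $G_1,G_2,G_k$ if, for $i=1,2$, $P_{i+k}(M)$ is controllable with respect to $L(G_i\parallel G_k)$ and $\Sigma_{i+k,u}$. The supremal conditionally controllable sublanguage of $K$ is the largest (with respect to inclusion) conditionally controllable sublanguage of $K$; it exists and equals the union of all conditionally controllable sublanguages of $K$. *)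

(* Defs.v *)
From mathcomp Require Import all_boot.
From mathcomp Require Import boolp classical_sets.

Set Implicit Arguments.
Unset Strict Implicit.
Unset Printing Implicit Defensive.

Local Open Scope classical_set_scope.

(* Alphabets are finite sets of events A : {set E}, taken in an
   ambient finite type E which may contain events of no alphabet under
   consideration. Words are sequences of events, and a language over A is a
   [set (seq E)] included in [words A]. *)

Section Languages.
Variable E : finType.
Implicit Types (A B U : {set E}) (L M N : set (seq E)).

Definition words A : set (seq E) := [set s | all [in A] s].

Definition proj A (s : seq E) : seq E := [seq a <- s | a \in A].

Definition prefix_closure L : set (seq E) := [set s | exists t, L (s ++ t)].

Definition sync A B L M : set (seq E) :=
  words (A :|: B) `&` (proj A @^-1` L `&` proj B @^-1` M).

Definition sync_nonconflicting A B L M : Prop :=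
  prefix_closure (sync A B L M) =
  sync A B (prefix_closure L) (prefix_closure M).

Definition controllable L U M : Prop :=
  forall (s : seq E) (a : E),
    prefix_closure M s -> a \in U -> L (rcons s a) ->
    prefix_closure M (rcons s a).

Definition supC L U M : set (seq E) :=
  \bigcup_(N in [set N | N `<=` M /\ controllable L U N]) N.

Definition cond_decomposable (S1 S2 Sk : {set E}) M : Prop :=
  M = sync (S1 :|: Sk) (S2 :|: Sk)
        (proj (S1 :|: Sk) @` M) (proj (S2 :|: Sk) @` M).

End Languages.

(* [trans q a = None] means that the transition is undefined; [trans_alphabet]
   makes [trans] a partial function on [state * A]. *)
Record generator (E : finType) (A : {set E}) := Generator {
  state : finType;
  trans : state -> E -> option state;
  init : state;
  marked : {set state};
  alphabet_neq0 : A != finset.set0;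
  trans_alphabet : forall q a, a \notin A -> trans q a = None
}.

Section Generators.
Variable E : finType.
Implicit Types A B : {set E}.

Definition run A (G : generator A) (s : seq E) : option (state G) :=
  foldl (fun oq a => obind (fun q => trans q a) oq) (Some (init G)) s.

Definition lang A (G : generator A) : set (seq E) := [set s | run G s != None].

Definition marked_lang A (G : generator A) : set (seq E) :=
  [set s | exists2 q, run G s = Some q & q \in marked G].

Lemma run_rcons A (G : generator A) s a :
  run G (rcons s a) = obind (fun q => trans q a) (run G s).
Proof. by rewrite /run foldl_rcons. Qed.

Section SyncProduct.
Variables (A B : {set E}) (G : generator A) (H : generator B).

Definition sync_trans (q : state G * state H) (a : E) :
    option (state G * state H) :=
  match a \in A, a \in B with
  | true, true =>
      obind (fun p1 => omap (fun p2 => (p1, p2)) (trans q.2 a)) (trans q.1 a)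
  | true, false => omap (fun p1 => (p1, q.2)) (trans q.1 a)
  | false, true => omap (fun p2 => (q.1, p2)) (trans q.2 a)
  | false, false => None
  end.

Lemma sync_alphabet_neq0 : A :|: B != finset.set0.
Proof. by rewrite finset.setU_eq0 negb_and (alphabet_neq0 G). Qed.

Lemma sync_trans_alphabet q a : a \notin A :|: B -> sync_trans q a = None.
Proof.
by rewrite inE negb_or /sync_trans => /andP[/negbTE-> /negbTE->].
Qed.

Definition sync_gen : generator (A :|: B) :=
  @Generator E (A :|: B) (state G * state H)%type sync_trans
    (init G, init H) (finset.setX (marked G) (marked H))
    sync_alphabet_neq0 sync_trans_alphabet.

Lemma run_sync_gen s :
  run sync_gen s =
  if all [in A :|: B] s then
    obind (fun p => omap (fun q => (p, q)) (run H (proj B s)))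
      (run G (proj A s))
  else None.
Proof.
elim/last_ind: s => [//|s a IHs].
rewrite run_rcons IHs all_rcons /proj !filter_rcons -/(proj A s) -/(proj B s).
rewrite finset.in_setU; case: (all _ s); last by rewrite andbF.
rewrite andbT /= /sync_trans.
case aA: (a \in A); case aB: (a \in B); rewrite ?run_rcons /=;
  case: (run G _) => [p|] //=; case: (run H _) => [q|] //=;
  rewrite ?aA ?aB //=; by case: (trans p a).
Qed.

Lemma lang_sync_gen : lang sync_gen = sync A B (lang G) (lang H).
Proof.
apply/seteqP; split=> s; rewrite /lang /sync /words /= run_sync_gen.
  by case: ifP => //= _; case: (run G _) => [p|] //=; case: (run H _).
by case=> -> []; case: (run G _) => [p|] //=; case: (run H _).
Qed.

Lemma marked_lang_sync_gen :
  marked_lang sync_gen = sync A B (marked_lang G) (marked_lang H).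
Proof.
apply/seteqP; split=> s; rewrite /marked_lang /sync /words /= run_sync_gen.
  case=> -[p q]; case: ifP => //= _.
  case: (run G _) => [p'|] //=; case: (run H _) => [q'|] //= [<- <-].
  by rewrite finset.in_setX => /andP[pm qm]; split=> //; split;
    [exists p' | exists q'].
case=> -> [[p -> pm] [q -> qm]]; exists (p, q) => //=.
by rewrite finset.in_setX pm.
Qed.

End SyncProduct.

Section CondControllability.
Variables (S1 S2 Sk : {set E}).
Variables (G1 : generator S1) (G2 : generator S2) (Gk : generator Sk).
Variable Su : {set E}.
Implicit Types K M : set (seq E).

Definition cond_controllable M : Prop :=
  [/\ M `<=` marked_lang (sync_gen (sync_gen G1 G2) Gk),
      controllable (lang (sync_gen G1 Gk)) ((S1 :|: Sk) :&: Su)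
        (proj (S1 :|: Sk) @` M) &
      controllable (lang (sync_gen G2 Gk)) ((S2 :|: Sk) :&: Su)
        (proj (S2 :|: Sk) @` M)].

Definition is_supremal_cond_controllable K M : Prop :=
  [/\ M `<=` K, cond_controllable M &
      forall N, N `<=` K -> cond_controllable N -> N `<=` M].

End CondControllability.
End Generators.

(* Main.v *)
(* Put A = S1 :|: Sk and B = S2 :|: Sk, so that A :&: B = Sk. Two words over A
   and B with the same projection to Sk can be interleaved into a word that
   projects to both of them. Hence, in the nonconflicting case, the prefixes of
   the words of the projection to A of supC1 || supC2 are the prefixes t of
   words of supC1 whose projection to Sk is that of a prefix of a word of
   supC2. When t is extended by an uncontrollable event, the first condition
   persists by controllability of supC1 and the second one by the
   controllability assumption over Sk. Maximality holds because the projections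
   of a conditionally controllable sublanguage lie in supC1 and supC2. *)
Require Import Defs.
From mathcomp Require Import all_boot.
From mathcomp Require Import boolp classical_sets.

Set Implicit Arguments.
Unset Strict Implicit.
Unset Printing Implicit Defensive.

Local Open Scope classical_set_scope.

Section Projections.
Variable E : finType.
Implicit Types (A B U : {set E}) (L M N : set (seq E)).

Lemma proj_cat A s t : proj A (s ++ t) = proj A s ++ proj A t.
Proof. exact: filter_cat. Qed.

Lemma proj_rcons A s a :
  proj A (rcons s a) = if a \in A then rcons (proj A s) a else proj A s.
Proof. exact: filter_rcons. Qed.

Lemma proj_id A s : words A s -> proj A s = s.
Proof. by move/all_filterP. Qed.

Lemma proj_words A s : words A (proj A s).
Proof. exact: filter_all. Qed.

Lemma proj_proj A B s : proj B (proj A s) = proj (A :&: B) s.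
Proof.
rewrite /proj -filter_predI; apply: eq_filter => a.
by rewrite /= inE andbC.
Qed.

Lemma projIl A B s : proj (A :&: B) (proj A s) = proj (A :&: B) s.
Proof. by rewrite proj_proj finset.setIA finset.setIid. Qed.

Lemma projIr A B s : proj (A :&: B) (proj B s) = proj (A :&: B) s.
Proof. by rewrite finset.setIC projIl. Qed.

(** The cut falls right after the letter of [s] that yields the last letter of [t]; erased letters
    that follow go to [s2]. *)
Lemma proj_eq_cat A s t w : proj A s = t ++ w ->
  exists s1 s2, [/\ s = s1 ++ s2, proj A s1 = t & proj A s2 = w].
Proof.
elim: s t => [|x s IHs] [|y t] //=.
- by move=> <-; exists [::], [::].
- by move=> e; exists [::], (x :: s).
- case: ifPn => [xA [<- /IHs[s1 [s2 [-> <- <-]]]]|xA].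
    by exists (x :: s1), s2; rewrite /= xA.
  move=> /(IHs (y :: t))[s1 [s2 [-> e <-]]].
  by exists (x :: s1), s2; rewrite /= (negbTE xA).
Qed.

Lemma prefix_closure_proj A L :
  prefix_closure (proj A @` L) = proj A @` prefix_closure L.
Proof.
apply/seteqP; split=> t.
  case=> w [s Ls /proj_eq_cat[s1 [s2 [es <- _]]]].
  by exists s1 => //; exists s2; rewrite -es.
by case=> s [w Lsw] <-; exists (proj A w), (s ++ w) => //; rewrite proj_cat.
Qed.

Lemma prefix_closureS L M : L `<=` M -> prefix_closure L `<=` prefix_closure M.
Proof. by move=> LM s [t /LM Mst]; exists t. Qed.

Lemma prefix_closure_words A L : L `<=` words A -> prefix_closure L `<=` words A.
Proof. by move=> LA s [t /LA]; rewrite /words /= all_cat => /andP[]. Qed.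

(** Nested induction on [s] and [t]: a leading letter private to one alphabet is emitted alone, and
    two shared leading letters must coincide because the projections agree, so they are emitted
    once. *)
Lemma interleave A B s t : words A s -> words B t ->
  proj (A :&: B) s = proj (A :&: B) t ->
  exists u, [/\ words (A :|: B) u, proj A u = s & proj B u = t].
Proof.
rewrite /words /=.
elim: s t => [|x s IHs].
  (* As [t] is over [B], its projection to [A] is its projection to [A :&: B], which is empty
     here. *)
  move=> t _ tB /esym e; exists t; split; last exact: proj_id.
    by apply: sub_all tB => a /=; rewrite inE orbC => ->.
  by rewrite -[t in LHS](proj_id tB) proj_proj finset.setIC.
elim=> [|y t IHt] sA tB.
  move=> e; have xB : x \notin B.
    by move: sA e => /= /andP[xA _]; rewrite inE xA /=; case: ifP.
  case/andP: sA => xA sA.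
  have [|u [uAB us ut]] := IHs [::] sA isT.
    by move: e; rewrite [LHS]/= inE (negbTE xB) andbF.
  by exists (x :: u); rewrite /= inE xA (negbTE xB) us.
case: (boolP (x \in B)) => xB e; last first.
  case/andP: sA => xA sA.
  have [|u [uAB us ut]] := IHs (y :: t) sA tB.
    by move: e; rewrite [LHS]/= inE (negbTE xB) andbF.
  by exists (x :: u); rewrite /= inE xA (negbTE xB) us.
case: (boolP (y \in A)) => yA; last first.
  case/andP: tB => yB tB.
  have [|u [uAB us ut]] := IHt sA tB.
    by move: e; rewrite [RHS]/= inE (negbTE yA).
  by exists (y :: u); rewrite /= inE yB (negbTE yA) orbT ut.
move: sA tB e => /= /andP[xA sA] /andP[yB tB].
rewrite !inE xA xB yA yB /= => -[<- e].
have [u [uAB us ut]] := IHs t sA tB e.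
by exists (x :: u); rewrite /= inE xA xB us ut.
Qed.

Lemma syncC A B L M : sync A B L M = sync B A M L.
Proof. by rewrite /sync finset.setUC (setIC (_ @^-1` L)). Qed.

Lemma syncS A B L M L' M' : L `<=` L' -> M `<=` M' ->
  sync A B L M `<=` sync A B L' M'.
Proof. by move=> LL MM s [sw [/LL Ls /MM Ms]]. Qed.

Lemma sync_nonconflictingC A B L M :
  sync_nonconflicting A B L M -> sync_nonconflicting B A M L.
Proof. by rewrite /sync_nonconflicting syncC => ->; rewrite syncC. Qed.

Lemma supC_sub L U M : supC L U M `<=` M.
Proof. by move=> s [N [NM _] /NM]. Qed.

Lemma sub_supC L U M N : N `<=` M -> controllable L U N -> N `<=` supC L U M.
Proof. by move=> NM cN s Ns; exists N. Qed.

(** Controllability concerns one prefix at a time, and a prefix of a word of the union already comes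
    from a single member [N]. *)
Lemma controllable_supC L U M : controllable L U (supC L U M).
Proof.
move=> s a [t [N [NM cN] Nst]] aU Lsa.
have [|w Nw] := cN s a _ aU Lsa; first by exists t.
by exists w, N.
Qed.

(** Prefix closure commutes with projection, and nonconflict moves it inside the product;
    [interleave] then lifts [t] to a word of the product of the closures. *)
Lemma proj_sync_prefix A B L M : L `<=` words A -> M `<=` words B ->
  sync_nonconflicting A B L M ->
  prefix_closure (proj A @` sync A B L M) =
  prefix_closure L `&`
    proj (A :&: B) @^-1` prefix_closure (proj (A :&: B) @` M).
Proof.
move=> LA MB nc; rewrite !prefix_closure_proj nc.
apply/seteqP; split=> t.
  case=> s [_ [Ls Ms]] <-; split=> //; exists (proj B s) => //.
  by rewrite projIl projIr.
case=> Lt [v Mv e].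
have tA := prefix_closure_words LA Lt.
have vB := prefix_closure_words MB Mv.
have [u [uAB ut uv]] := interleave tA vB (esym e).
by exists u => //; split=> //; split; rewrite /preimage /= ?ut ?uv.
Qed.

Lemma controllable_proj_sync A B L L0 U U0 M N :
  M `<=` words A -> N `<=` words B -> sync_nonconflicting A B M N ->
  L `<=` proj (A :&: B) @^-1` L0 -> U :&: (A :&: B) \subset U0 ->
  controllable L U M ->
  controllable L0 U0 (proj (A :&: B) @` M `&` proj (A :&: B) @` N) ->
  controllable L U (proj A @` sync A B M N).
Proof.
move=> MA NB nc LL0 UU0 cM cMN t a tMN aU Lta.
have := tMN; rewrite (proj_sync_prefix MA NB nc) => -[Mt Nt].
split; first exact: cM.
rewrite /preimage /= proj_rcons; case: ifPn => // aAB.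
have : prefix_closure (proj (A :&: B) @` M `&` proj (A :&: B) @` N)
    (rcons (proj (A :&: B) t) a).
  apply: cMN.
  (* A prefix of a word of the intersection needs one continuation valid for both languages: the
     word [s] of the product, whose projection to [A] is [t ++ w], provides it. *)
  - case: tMN => w [s [_ [Ms Ns]] e].
    exists (proj (A :&: B) w); rewrite -proj_cat -e projIl; split.
      by exists (proj A s); rewrite ?projIl.
    by exists (proj B s); rewrite ?projIr.
  - by apply: (fintype.subsetP UU0); rewrite finset.in_setI aU.
  - by have := LL0 _ Lta; rewrite /preimage /= proj_rcons aAB.
by apply: prefix_closureS => s [].
Qed.

End Projections.

Theorem corollary14 (E : finType) (S1 S2 Sk Sc : {set E})
    (G1 : generator S1) (G2 : generator S2) (Gk : generator Sk)
    (K : set (seq E)) :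
  let Su := (S1 :|: S2) :\: Sc in
  let supC1 := supC (lang (sync_gen G1 Gk)) ((S1 :|: Sk) :&: Su)
                 (proj (S1 :|: Sk) @` K) in
  let supC2 := supC (lang (sync_gen G2 Gk)) ((S2 :|: Sk) :&: Su)
                 (proj (S2 :|: Sk) @` K) in
  S1 :&: S2 \subset Sk ->
  Sk \subset S1 :|: S2 ->
  Sc \subset S1 :|: S2 ->
  K `<=` marked_lang (sync_gen (sync_gen G1 G2) Gk) ->
  cond_decomposable S1 S2 Sk K ->
  cond_decomposable S1 S2 Sk (prefix_closure K) ->
  sync_nonconflicting (S1 :|: Sk) (S2 :|: Sk) supC1 supC2 ->
  controllable (lang Gk) (Sk :&: Su) (proj Sk @` supC1 `&` proj Sk @` supC2) ->
  is_supremal_cond_controllable G1 G2 Gk Su K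
    (sync (S1 :|: Sk) (S2 :|: Sk) supC1 supC2).
Proof.
move=> Su supC1 supC2 S12k _ _ KLm decK _ nc cSk.
have capE : (S1 :|: Sk) :&: (S2 :|: Sk) = Sk.
  by rewrite -finset.setUIl; apply/finset.setUidPr.
have capE' : (S2 :|: Sk) :&: (S1 :|: Sk) = Sk by rewrite finset.setIC.
have sub1 : supC1 `<=` proj (S1 :|: Sk) @` K by exact: supC_sub.
have sub2 : supC2 `<=` proj (S2 :|: Sk) @` K by exact: supC_sub.
have words1 : supC1 `<=` words (S1 :|: Sk).
  by move=> s /sub1[t _ <-]; exact: proj_words.
have words2 : supC2 `<=` words (S2 :|: Sk).
  by move=> s /sub2[t _ <-]; exact: proj_words.
have langk (S : {set E}) (G : generator S) :
    lang (sync_gen G Gk) `<=` proj Sk @^-1` lang Gk.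
  by rewrite lang_sync_gen => s [_ []].
have eventsk (S : {set E}) : (S :|: Sk) :&: Su :&: Sk \subset Sk :&: Su.
  by rewrite finset.setIC finset.setIS // finset.subsetIr.
(* Decomposability rebuilds [K] from its two projections, which contain [supC1] and [supC2]. *)
have subK : sync (S1 :|: Sk) (S2 :|: Sk) supC1 supC2 `<=` K.
  by rewrite decK; exact: syncS.
split=> //.
  split; first exact: subset_trans KLm.
    apply: (controllable_proj_sync (L0 := lang Gk) (U0 := Sk :&: Su)) => //;
      rewrite ?capE //.
    exact: controllable_supC.
  (* The second index follows from the same lemma with the two components exchanged. *)
  rewrite syncC.
  apply: (controllable_proj_sync (L0 := lang Gk) (U0 := Sk :&: Su)) => //;
    rewrite ?capE' //; first exact: sync_nonconflictingC.
  - exact: controllable_supC.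
  - by rewrite setIC.
move=> N NK [_ cN1 cN2] s Ns; split.
  (* Decomposability serves here only to see that words of [K] are over the union of the
     alphabets. *)
  by have := NK _ Ns; rewrite decK => -[].
by split; [apply: (sub_supC (image_subset NK) cN1)
  | apply: (sub_supC (image_subset NK) cN2)]; exists s.
Qed.
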